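(* Let $b_0\ge b_1\ge\cdots\ge b_n$ be non-negative integers and write $d=b_0+\cdots+b_n$. Then $$S_{(b_0,b_1,\dots,b_n),\lfloor d/2\rfloor}\ \le\ \underline{R}(x_0^{b_0}x_1^{b_1}\cdots x_n^{b_n})\ \le\ T_{(b_1,\dots,b_n)},$$ where $x_0,\dots,x_n$ are independent variables over $\mathbb C$.
   Context: For a tuple $\mathbf b=(b_1,\dots,b_m)$ of non-negative integers and an integer $\delta$, $S_{\mathbf b,\delta}$ is the number of distinct $m$-tuples of integers $(a_1,\dots,a_m)$ with $a_1+\cdots+a_m=\delta$ and $0\le a_j\le b_j$ for all $j$ (in the claim this is applied to the $(n+1)$-tuple $(b_0,\dots,b_n)$), and $T_{\mathbf b}=\prod_{i=1}^m(1+b_i)$. The rank $R(\phi)$ of a complex homogeneous polynomial $\phi$ of degree $d$ is the smallest $r$ such that $\phi$ is a sum of $r$ $d$-th powers of linear forms. The border rank $\underline{R}(\phi)$ is the smallest $r$ such that $\phi$ lies in the Zariski closure (in the space of homogeneous polynomials of degree $d$ in the given variables) of the set of polynomials of rank at most $r$. *)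

(* Defs.v *)
From mathcomp Require Import all_boot all_order all_algebra.
From mathcomp Require Import complex reals mpoly.

Set Implicit Arguments.
Unset Strict Implicit.
Unset Printing Implicit Defensive.

Import GRing.Theory.
Local Open Scope ring_scope.

Definition is_least (P : nat -> Prop) (r : nat) : Prop :=
  P r /\ forall s, P s -> (r <= s)%N.

(* The closed sets are the zero loci of polynomials in the coordinates with
   respect to a basis of [V]; they do not depend on the basis, because a linear
   change of coordinates maps polynomials to polynomials. *)
Definition zariski_closure (C : fieldType) (V : vectType C) (A : V -> Prop)
    (v : V) : Prop :=
  forall F : {mpoly C[\dim {:V}]},
    (forall a, A a -> F.@[fun i => coord (vbasis {:V}) i a] = 0) ->
    F.@[fun i => coord (vbasis {:V}) i v] = 0.

Section Rank.
Context (C : fieldType) (n d : nat).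
Implicit Types (phi : dhomog n.+1 C d) (r : nat).

Definition sum_of_powers phi r : Prop :=
  exists L : 'I_r -> dhomog n.+1 C 1,
    mpoly_of_dhomog phi = \sum_(i < r) mpoly_of_dhomog (L i) ^+ d.

(* Rank and border rank are relations "[phi] has (border) rank [r]" rather than
   functions, so that no default value is needed where the minimum does not
   exist.  By [is_least] there is at most one such [r]. *)
Definition is_rank phi r : Prop := is_least (sum_of_powers phi) r.

Definition rank_at_most r phi : Prop := exists2 s, (s <= r)%N & is_rank phi s.

Definition is_border_rank phi r : Prop :=
  is_least (fun s => zariski_closure (rank_at_most s) phi) r.

End Rank.

Section Monomial.
Context (C : fieldType) (n : nat) (b : 'I_n -> nat).

Lemma monomial_homog :
  (\prod_(i < n) 'X_i ^+ b i : {mpoly C[n]}) \is (\sum_(i < n) b i).-homog.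
Proof.
elim/big_ind2: _ => [|p d q e hp hq|i _]; first exact: dhomog1.
  exact: dhomogM.
by rewrite -[X in X.-homog]mul1n; apply: dhomogMn; rewrite dhomogX /= mdeg1.
Qed.

Definition monomial : dhomog n C (\sum_(i < n) b i) := DHomog monomial_homog.

End Monomial.

Definition S_count (m : nat) (b : 'I_m -> nat) (delta : int) : nat :=
  #|[set a : {dffun forall j : 'I_m, 'I_(b j).+1}
      | \sum_(j < m) (a j : nat)%:Z == delta]|.

Definition T_count (m : nat) (b : 'I_m -> nat) : nat :=
  (\prod_(i < m) (1 + b i))%N.

(* Main.v *)
Require Import Defs.
From mathcomp Require Import all_boot all_order all_algebra.
From mathcomp Require Import complex reals mpoly boolp.
From mathcomp Require Import ring.

Import Order.TTheory GRing.Theory Num.Theory.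

Set Implicit Arguments.
Unset Strict Implicit.
Unset Printing Implicit Defensive.

Local Open Scope ring_scope.

(* Lower bound: over the exponents [a] of the factors of degree [delta] of
   x^b, the matrix of the pairings of the operators with exponent [a + (b - a')]
   against [phi] depends linearly on [phi] and has rank at most one on the power
   of a linear form, so its determinant is a polynomial that vanishes on the
   forms of rank < S; on x^b the matrix is the nonzero scalar b_0! ... b_n!.

   Upper bound: choose weights w_i such that sum_(k <= b_i) w_i(k) k^e is 0 for
   e < b_i and 1 for e = b_i.  In the sum over the T tuples k of
     (prod_i w_i(k_i)) (x_0 + t (k_1 x_1 + ... + k_n x_n))^d
   only the monomials x^c with c_i >= b_i for all i >= 1 survive; hence it is
   t^(b_1 + ... + b_n) times a curve whose value at t = 0 is a nonzero multiple
   of x^b, while for t != 0 the curve consists of forms of rank at most T. *)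

(** * Generalities on rank and closure *)

Lemma is_least_exists (P : nat -> Prop) (r : nat) :
  P r -> exists2 s, (s <= r)%N & is_least P s.
Proof.
elim/ltn_ind: r => r IHr Pr.
have [[s [lt_sr Ps]]|noP] := pselect (exists s, (s < r)%N /\ P s).
  have [q le_qs minq] := IHr s lt_sr Ps.
  by exists q => //; apply: leq_trans le_qs (ltnW lt_sr).
exists r => //; split=> // s Ps; rewrite leqNgt; apply/negP => lt_sr.
by apply: noP; exists s.
Qed.

Lemma rank_at_most_sum (C : fieldType) (n d : nat) (phi : dhomog n.+1 C d)
    (r s : nat) :
  sum_of_powers phi s -> (s <= r)%N -> rank_at_most r phi.
Proof.
move=> /is_least_exists[q le_qs rk_q] le_sr.
by exists q => //; apply: leq_trans le_sr.
Qed.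

Lemma zariski_closure_sub (C : fieldType) (V : vectType C) (A : V -> Prop) v :
  A v -> zariski_closure A v.
Proof. by move=> Av F; apply. Qed.

(** * Coefficients of powers of linear forms *)

Definition multifact {n : nat} (m : 'X_{1..n}) : nat := (\prod_i (m i)`!)%N.

Lemma multifact_gt0 n (m : 'X_{1..n}) : (0 < multifact m)%N.
Proof. by rewrite prodn_gt0 // => i; apply: fact_gt0. Qed.

Lemma multifactDU n (m : 'X_{1..n}) i :
  multifact (m + U_(i))%MM = ((m i).+1 * multifact m)%N.
Proof.
rewrite /multifact (bigD1 i) //= [in RHS](bigD1 i) //= mulnA.
rewrite mnmDE mnm1E eqxx addn1 factS; congr (_ * _)%N.
by apply: eq_bigr => j nji; rewrite mnmDE mnm1E eq_sym (negPf nji) addn0.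
Qed.

Lemma mderivXn n (C : comNzRingType) (p : {mpoly C[n]}) i k :
  (p ^+ k.+1)^`M(i) = k.+1%:R *: (p ^+ k * p^`M(i)).
Proof.
elim: k => [|k IHk]; first by rewrite expr1 expr0 mul1r scale1r.
rewrite exprS mderivM IHk -scalerAr mulrA -exprS mulrC.
by rewrite -[in X in _ = X]natr1 addrC scalerDl scale1r.
Qed.

(** The multinomial theorem with denominators cleared, hence valid over any commutative ring. The
    induction on [d] compares coefficients in the derivative of the power along a variable that
    occurs in [m]. *)
Lemma mcoeff_linear_formX n (C : comNzRingType) (l : 'I_n -> C) (d : nat)
    (m : 'X_{1..n}) : mdeg m = d ->
  (multifact m)%:R * ((\sum_i l i *: 'X_i) ^+ d : {mpoly C[n]})@_m
    = d`!%:R * \prod_i l i ^+ m i.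
Proof.
set L := \sum_i _.
have dL i : L^`M(i) = (l i)%:MP.
  rewrite linear_sum (bigD1 i) //= big1 => [|j nji]; last first.
    by rewrite mderivZ mderivX mnm1E (negPf nji) scale0r scaler0.
  rewrite mderivZ mderivX mnm1E eqxx scale1r addr0.
  have -> : (U_(i) - U_(i) = 0 :> 'X_{1..n})%MM.
    by apply/mnmP => j; rewrite mnmBE subnn mnm0E.
  by rewrite mpolyX0 -mul_mpolyC mulr1.
elim: d m => [|d IHd] m dm.
  have -> : m = 0%MM by apply/eqP; rewrite -mdeg_eq0 dm.
  by rewrite expr0 mcoeff1 eqxx /multifact !big1 // => i _; rewrite mnm0E.
have [i mi] : exists i, (0 < m i)%N.
  apply/existsP; apply: contraPT dm => /existsPn h.
  by rewrite mdegE big1 // => i _; apply/eqP; move: (h i); case: (m i).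
have Em : m = (m - U_(i) + U_(i))%MM.
  rewrite submK //; apply/mnm_lepP => j; rewrite mnm1E.
  by case: eqP => [<-|].
move: Em dm; set m' := (m - _)%MM => -> {mi}.
rewrite mdegD mdeg1 addn1 => -[dm'].
have := congr1 (mcoeff m') (mderivXn L i d).
rewrite mcoeff_mderiv dL mcoeffZ [_ * _%:MP]mulrC mcoeffCM => E.
have -> : \prod_j l j ^+ (m' + U_(i))%MM j = l i * \prod_j l j ^+ m' j.
  under eq_bigr => j _ do rewrite mnmDE addnC exprD.
  rewrite big_split /= (bigD1 i) //= mnm1E eqxx expr1 big1 ?mulr1 // => j nji.
  by rewrite mnm1E eq_sym (negPf nji).
rewrite multifactDU natrM mulrAC [_ * _@__]mulrC.
rewrite [_ * (m' i).+1%:R]mulr_natr {}E factS natrM.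
by rewrite -!mulrA [d`!%:R * _]mulrCA -IHd //; ring.
Qed.

Lemma dhomog1_linear_form (C : nzRingType) n (L : dhomog n C 1) :
  mpoly_of_dhomog L = \sum_i L@_U_(i) *: 'X_i.
Proof.
apply/mpolyP => m; rewrite linear_sum /=.
have [/mdeg1P[i /eqP ->]|dm] := boolP (mdeg m == 1%N).
  rewrite (bigD1 i) //= mcoeffZ mcoeffX eqxx mulr1 big1 ?addr0 // => j nji.
  by rewrite mcoeffZ mcoeffX eq_mnm1 (negPf nji) mulr0.
rewrite (dhomog_nemf_coeff (dhomog_is_dhomog L) dm) big1 // => j _.
rewrite mcoeffZ mcoeffX; case: eqP => [Em|]; last by rewrite mulr0.
by rewrite -Em mdeg1 in dm.
Qed.

(** * Lower bound: catalecticant matrices *)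

Section Catalecticant.
Context (C : fieldType) (n d N : nat) (u v : 'I_N -> 'X_{1..n.+1}).

(* Entry (i, j) is the constant obtained by applying the differential operator
   with exponent [u i + v j] to [phi]. *)
Definition catalecticant (phi : {mpoly C[n.+1]}) : 'M[C]_N :=
  \matrix_(i, j) ((multifact (u i + v j)%MM)%:R * phi@_(u i + v j)).

(** On one power of a linear form with coefficients [l], entry (i, j) splits as d! l^(u i) times
    l^(v j); the r powers thus give a factorization through dimension r. *)
Lemma catalecticant_rank (phi : dhomog n.+1 C d) r :
  (forall i j, mdeg (u i + v j)%MM = d) ->
  sum_of_powers phi r -> (\rank (catalecticant phi) <= r)%N.
Proof.
move=> duv [L Ephi].
pose l k i := (L k)@_U_(i).
have -> : catalecticant phi =
    (\matrix_(i < N, k < r) (d`!%:R * \prod_x l k x ^+ u i x)) *m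
    (\matrix_(k < r, j < N) \prod_x l k x ^+ v j x).
  apply/matrixP => i j; rewrite !mxE Ephi raddf_sum /= mulr_sumr.
  apply: eq_bigr => k _; rewrite !mxE dhomog1_linear_form.
  rewrite mcoeff_linear_formX // -mulrA -big_split /=; congr (_ * _).
  by apply: eq_bigr => x _; rewrite mnmDE exprD.
by apply: leq_trans (mxrankM_maxl _ _) (rank_leq_col _).
Qed.

Lemma catalecticant_coord (phi : dhomog n.+1 C d) :
  catalecticant phi =
  \sum_k coord (vbasis {:dhomog n.+1 C d}) k phi
           *: catalecticant (vbasis {:dhomog n.+1 C d})`_k.
Proof.
apply/matrixP => i j; rewrite summxE mxE.
rewrite {1}(coord_vbasis (memvf phi)) !linear_sum mulr_sumr /=.
  by apply: eq_bigr => k _; rewrite !mxE (mcoeffZ _ (mpoly_of_dhomog _)) mulrCA.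
Qed.

Lemma catalecticant_border (phi : dhomog n.+1 C d) s :
  (forall i j, mdeg (u i + v j)%MM = d) ->
  zariski_closure (rank_at_most s) phi -> (s < N)%N ->
  \det (catalecticant phi) = 0.
Proof.
move=> duv clphi lt_sN.
(* The generic catalecticant, with linear forms in the coordinates as entries; its determinant is
   the polynomial to test the closure with. *)
pose M := \matrix_(i < N, j < N) \sum_(k < \dim {:dhomog n.+1 C d})
  catalecticant (vbasis {:dhomog n.+1 C d})`_k i j *: 'X_k.
have evalM psi : (\det M).@[fun i => coord (vbasis {:dhomog n.+1 C d}) i psi]
    = \det (catalecticant psi).
  rewrite -det_map_mx; congr (\det _); apply/matrixP => i j.
  rewrite [in RHS]catalecticant_coord summxE !mxE raddf_sum /=.
  by apply: eq_bigr => k _; rewrite mevalZ mevalXU [in RHS]mxE mulrC.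
rewrite -evalM; apply: clphi => psi [q le_qs [sum_q _]]; rewrite evalM.
apply/eqP; apply: contraTT lt_sN => nz; rewrite -leqNgt.
apply: leq_trans le_qs; apply: leq_trans (catalecticant_rank duv sum_q).
by rewrite mxrank_unit // unitmxE unitfE.
Qed.

End Catalecticant.

Lemma mpoly_of_monomial (C : fieldType) n (b : 'I_n -> nat) :
  mpoly_of_dhomog (monomial C b) = 'X_[[multinom b i | i < n]].
Proof. by rewrite /= mpolyXE_id; apply: eq_bigr => i _; rewrite mnmE. Qed.

Lemma border_rank_monomial_ge (C : numFieldType) n (b : 'I_n.+1 -> nat)
    (delta s : nat) :
  zariski_closure (rank_at_most s) (monomial C b) ->
  (S_count b delta%:Z <= s)%N.
Proof.
rewrite /S_count; set A := [set _ | _] => cl.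
pose u (i : 'I_#|A|) : 'X_{1..n.+1} :=
  [multinom (enum_val i j : nat) | j < n.+1].
pose beta : 'X_{1..n.+1} := [multinom b j | j < n.+1].
(* Complementary exponents: [u i + v j] equals [beta] exactly when [u i = u j], so only the diagonal
   entries see the monomial. *)
pose v i := (beta - u i)%MM.
have le_u i : (u i <= beta)%MM by apply/mnm_lepP => j; rewrite !mnmE -ltnS.
have du i : mdeg (u i) = delta.
  have := enum_valP i.
  rewrite inE -(big_morph Posz PoszD (erefl _)) => /eqP[<-].
  by rewrite mdegE; apply: eq_bigr => j _; rewrite mnmE.
have duv i j : mdeg (u i + v j)%MM = (\sum_i b i)%N.
  rewrite mdegD du -(du j) -mdegD addmC submK // mdegE.
  by apply: eq_bigr => k _; rewrite mnmE.
rewrite leqNgt; apply/negP => /(catalecticant_border duv cl) /eqP.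
have -> : catalecticant u v (monomial C b) = (multifact beta)%:R%:M.
  apply/matrixP => i j; rewrite !mxE mpoly_of_monomial mcoeffX -/beta.
  have [->|nij] := eqVneq i j.
    by rewrite addmC submK // eqxx mulr1.
  case: eqP => [E|]; last by rewrite mulr0.
  case/eqP: nij; apply: enum_val_inj; apply/ffunP => k; apply: val_inj.
  have /(congr1 (fun m : 'X_{1..n.+1} => m k)) : u i = u j.
    by apply: (addIm (x := v j)); rewrite -E [RHS]addmC submK.
  by rewrite !mnmE.
rewrite det_scalar expf_eq0 pnatr_eq0 => /andP[_ /eqP].
by have := multifact_gt0 beta; case: (multifact beta).
Qed.

(** * Upper bound: tools for the degeneration *)

Lemma zariski_closure_curve (C : numFieldType) (V : vectType C) (A : V -> Prop)
    (K : finType) (e : K -> nat) (v : K -> V) :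
  (forall t, t != 0 -> A (\sum_k t ^+ e k *: v k)) ->
  zariski_closure A (\sum_k 0 ^+ e k *: v k).
Proof.
move=> Acurve F F0.
pose h i : {poly C} := \sum_k coord (vbasis {:V}) i (v k) *: 'X^(e k).
pose G : {poly C} := \sum_(m <- msupp F) F@_m *: \prod_i h i ^+ m i.
have evalG t :
    G.[t] = F.@[fun i => coord (vbasis {:V}) i (\sum_k t ^+ e k *: v k)].
  rewrite mevalE horner_sum; apply: eq_bigr => m _.
  rewrite hornerZ horner_prod; congr (_ * _); apply: eq_bigr => i _.
  rewrite horner_exp horner_sum linear_sum; congr (_ ^+ _).
  by apply: eq_bigr => k _; rewrite hornerZ hornerXn linearZ /= mulrC.
rewrite -evalG; suff -> : G = 0 by rewrite horner0.
(* In characteristic 0 the points 1, 2, ..., [size G] are distinct and nonzero; they are more roots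
   than a nonzero [G] could have. *)
pose s : seq C := [seq k.+1%:R | k <- iota 0 (size G)].
apply: (@roots_geq_poly_eq0 _ _ s); last by rewrite size_map size_iota.
  apply/allP => _ /mapP[k _ ->]; rewrite /root evalG F0 //.
  by apply: Acurve; rewrite pnatr_eq0.
by rewrite map_inj_uniq ?iota_uniq // => i j /eqP; rewrite eqr_nat eqSS => /eqP.
Qed.

(** The conditions form a Vandermonde system at the nodes 0, ..., b; the weights are the last column
    of the inverse matrix. *)
Lemma interpolation_weights (C : numFieldType) (b : nat) :
  exists w : nat -> C, forall e, (e <= b)%N ->
    \sum_(k < b.+1) w k * k%:R ^+ e = (e == b)%:R.
Proof.
pose a : 'rV[C]_b.+1 := \row_j (j : nat)%:R.
have uV : Vandermonde b.+1 a \in unitmx.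
  rewrite unitmxE unitfE det_Vandermonde; apply/prodf_neq0 => i _.
  apply/prodf_neq0 => j lt_ij.
  by rewrite !mxE subr_eq0 eqr_nat; rewrite gtn_eqF.
pose w k := invmx (Vandermonde b.+1 a) (inord k) ord_max.
exists w => e le_eb; have /matrixP/(_ (inord e) ord_max) := mulmxV uV.
rewrite !mxE -val_eqE /= inordK // => <-.
by apply: eq_bigr => k _; rewrite !mxE /w inord_val inordK // mulrC.
Qed.

(** Each weight is absorbed into its linear form through a d-th root, which requires d > 0. *)
Lemma sum_of_powers_weighted (C : numClosedFieldType) n d (I : finType)
    (A : {pred I}) (W : I -> C) (L : I -> dhomog n.+1 C 1)
    (phi : dhomog n.+1 C d) : (0 < d)%N ->
  mpoly_of_dhomog phi = \sum_(i in A) W i *: mpoly_of_dhomog (L i) ^+ d ->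
  sum_of_powers phi #|A|.
Proof.
move=> d_gt0 Ephi.
exists (fun k => d.-root (W (enum_val k)) *: L (enum_val k)).
by rewrite Ephi big_enum_val; apply: eq_bigr => k _; rewrite /= exprZn rootCK.
Qed.

(** [indhomog d] defaults to 0 outside the forms of degree d, so the exponents of smaller degree in
    the index type contribute nothing. *)
Lemma mcoeff_dhomog_sum (C : nzRingType) n d (s E : 'X_{1..n} -> C) m :
  (mpoly_of_dhomog (\sum_(c : 'X_{1..n < d.+1})
       s c *: indhomog d (E c *: 'X_[c])))@_m
  = if mdeg m == d then s m * E m else 0.
Proof.
rewrite !linear_sum /=.
have term (c : 'X_{1..n < d.+1}) :
    (mpoly_of_dhomog (s c *: indhomog d (E c *: 'X_[c])))@_m
    = if (mdeg m == d) && (c == m :> 'X_{1..n}) then s m * E m else 0.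
  rewrite (mcoeffZ _ (mpoly_of_dhomog _)).
  have [dm|dm] := boolP (mdeg m == d); last first.
    by rewrite (dhomog_nemf_coeff (dhomog_is_dhomog _) dm) mulr0.
  have [cm|ncm] := eqVneq (c : 'X_{1..n}) m.
    rewrite /indhomog -[mpoly_of_dhomog _]/(val _) insubdK -?topredE /=.
      by rewrite mcoeffZ mcoeffX cm eqxx mulr1.
    by apply: dhomogZ; rewrite dhomogX cm.
  rewrite /indhomog -[mpoly_of_dhomog _]/(val _) val_insubd; case: ifP => _.
    by rewrite mcoeffZ mcoeffX (negPf ncm) !mulr0.
  by rewrite mcoeff0 mulr0.
rewrite (eq_bigr _ (fun c _ => term c)).
case: eqP => [dm|_]; last by rewrite big1.
have lt_m : (mdeg m < d.+1)%N by rewrite dm.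
rewrite (bigD1 (BMultinom lt_m)) //= eqxx big1 ?addr0 // => c nc.
by case: eqP => // cm; case/eqP: nc; apply: val_inj.
Qed.

(** * Upper bound: the curve through the monomial *)

Section UpperBound.
Context (C : numClosedFieldType) (n : nat) (b : 'I_n.+1 -> nat).
Let d := (\sum_i b i)%N.
Let tb (i : 'I_n) := b (lift ord0 i).
Let B := (\sum_i tb i)%N.
Let beta : 'X_{1..n.+1} := [multinom b i | i < n.+1].
Let tdeg (c : 'X_{1..n.+1}) := (\sum_(i < n) c (lift ord0 i))%N.
Context (w : 'I_n -> nat -> C)
  (wP : forall i e, (e <= tb i)%N ->
    \sum_(k < (tb i).+1) w i k * k%:R ^+ e = (e == tb i)%:R).
(** The common range ['I_d.+1] lets the product over [i] be expanded into a sum over functions. *)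
Let moment i e := \sum_(k < d.+1 | (k < (tb i).+1)%N) w i k * k%:R ^+ e.
(** For [c] of degree d, the coefficient of t^(tdeg c) x^c in the weighted sum of powers, rescaled
    so that [E beta] is 1. *)
Let E (c : 'X_{1..n.+1}) : C := (multifact beta)%:R / (multifact c)%:R
   * \prod_i moment i (c (lift ord0 i)).
(** The rescaled sum of powers divided by t^B. Truncated subtraction is harmless, since [E c]
    vanishes when [tdeg c < B]. *)
Let q (t : C) : dhomog n.+1 C d := \sum_(c : 'X_{1..n.+1 < d.+1})
   t ^+ (tdeg c - B) *: indhomog d (E c *: 'X_[c]).

Let qE t m : (mpoly_of_dhomog (q t))@_m =
  if mdeg m == d then t ^+ (tdeg m - B) * E m else 0.
Proof. exact: (mcoeff_dhomog_sum d (fun c => t ^+ (tdeg c - B)) E). Qed.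

Let le_tb i : (tb i <= d)%N.
Proof. by rewrite /d (bigD1 (lift ord0 i)) //= leq_addr. Qed.

Let momentE i e : (e <= tb i)%N -> moment i e = (e == tb i)%:R.
Proof.
move=> le_e; rewrite -wP // /moment.
by rewrite (big_ord_widen d.+1 (fun k : nat => w i k * k%:R ^+ e)) // ltnS.
Qed.

Let moments_eq0 (c : 'X_{1..n.+1}) : (tdeg c < B)%N ->
  \prod_i moment i (c (lift ord0 i)) = 0.
Proof.
move=> lt_cB; have [i lt_ci] : exists i, (c (lift ord0 i) < tb i)%N.
  apply/existsP; apply: contraTT lt_cB => /existsPn h; rewrite -leqNgt.
  by apply: leq_sum => i _; rewrite leqNgt.
by rewrite (bigD1 i) //= momentE ?(ltnW lt_ci) // (ltn_eqF lt_ci) mul0r.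
Qed.

Let q0 : q 0 = monomial C b.
Proof.
apply: val_inj; apply/mpolyP => m; rewrite [LHS]qE.
rewrite [val _]mpoly_of_monomial mcoeffX -/beta.
have dbeta : mdeg beta = d.
  by rewrite mdegE; apply: eq_bigr => i _; rewrite mnmE.
have tbeta : tdeg beta = B by apply: eq_bigr => i _; rewrite mnmE.
have [<-|nm] := eqVneq beta m.
  rewrite dbeta eqxx tbeta subnn expr0 mul1r /E divff ?mul1r; last first.
    by rewrite pnatr_eq0 -lt0n multifact_gt0.
  by rewrite big1 // => i _; rewrite mnmE momentE // eqxx.
case: eqP => // dm; rewrite expr0n; case: eqP => [/eqP|]; last by rewrite mul0r.
rewrite subn_eq0 => le_mB; rewrite mul1r /E.
(* Otherwise [tdeg m <= B] forces equality at every index above 0, and the total degree d then fixes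
   the exponent of x_0, so m would be [beta]. *)
have [i lt_mi] : exists i, (m (lift ord0 i) < tb i)%N.
  apply/existsP; apply: contraNT nm => /existsPn h.
  have le_tm i : (tb i <= m (lift ord0 i))%N by rewrite leqNgt.
  have eq_t i : tb i = m (lift ord0 i).
    apply/eqP; rewrite eqn_leq le_tm /= leqNgt; apply/negP => lt_i.
    move: le_mB; rewrite leqNgt => /negP; apply.
    rewrite /tdeg /B (bigD1 i) //= [ltnRHS](bigD1 i) //= -addSn leq_add //.
    by apply: leq_sum.
  apply/eqP/mnmP => j; rewrite mnmE.
  case: (unliftP ord0 j) => [i ->|->]; first exact: eq_t.
  apply/eqP; rewrite -(eqn_add2r B) -{1}/d.
  move/eqP: dm; rewrite mdegE big_ord_recl /d big_ord_recl eq_sym.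
  by rewrite (eq_bigr _ (fun i _ => esym (eq_t i))).
by rewrite (bigD1 i) //= momentE ?(ltnW lt_mi) // (ltn_eqF lt_mi) mul0r mulr0.
Qed.

Let q_sum (t : C) : (0 < d)%N -> t != 0 ->
  sum_of_powers (q t) (T_count tb).
Proof.
move=> d_gt0 t0.
pose A : {pred {ffun 'I_n -> 'I_d.+1}} :=
  family (fun i => [pred k : 'I_d.+1 | (k < (tb i).+1)%N]).
have -> : T_count tb = #|A|.
  rewrite card_family foldrE big_map big_enum; apply: eq_bigr => i _.
  rewrite add1n -[LHS]card_ord -!sum1_card.
  by rewrite (big_ord_widen d.+1 (fun=> 1%N)) ?ltnS.
pose l (f : {ffun 'I_n -> 'I_d.+1}) (i : 'I_n.+1) : C :=
  if unlift ord0 i is Some j then t * (f j : nat)%:R else 1.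
pose L f : dhomog n.+1 C 1 := indhomog 1 (\sum_i l f i *: 'X_i).
have LE f : mpoly_of_dhomog (L f) = \sum_i l f i *: 'X_i.
  rewrite /L /indhomog -[mpoly_of_dhomog _]/(val _) insubdK // -topredE /=.
  by apply: rpred_sum => i _; apply: dhomogZ; rewrite dhomogX /= mdeg1.
(* The factor t^(-B) performs the division by t^B, and beta!/d! is the normalization built into
   [E]. *)
apply: (@sum_of_powers_weighted _ _ _ _ A (fun f => t ^- B *
   ((multifact beta)%:R / d`!%:R * \prod_i w i (f i))) L) => //.
apply/mpolyP => m; rewrite qE linear_sum /=.
have [dm|dm] := boolP (mdeg m == d); last first.
  rewrite big1 // => f _; rewrite mcoeffZ.
  have hLd : mpoly_of_dhomog (L f) ^+ d \is d.-homog.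
    by rewrite -[X in X.-homog]mul1n; apply: dhomogMn; apply: dhomog_is_dhomog.
  by rewrite (dhomog_nemf_coeff hLd dm) mulr0.
have fact_neq0 k : (k`!)%:R != 0 :> C by rewrite pnatr_eq0 -lt0n fact_gt0.
have mf_neq0 : (multifact m)%:R != 0 :> C.
  by rewrite pnatr_eq0 -lt0n multifact_gt0.
have coefL f : (mpoly_of_dhomog (L f) ^+ d)@_m =
    d`!%:R / (multifact m)%:R *
    (t ^+ tdeg m * \prod_i (f i : nat)%:R ^+ m (lift ord0 i)).
  apply: (mulfI mf_neq0); rewrite LE (mcoeff_linear_formX _ (eqP dm)).
  rewrite mulrA [(multifact m)%:R * _]mulrC divfK //; congr (_ * _).
  rewrite big_ord_recl /l unlift_none expr1n mul1r -prodrXr -big_split /=.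
  by apply: eq_bigr => i _; rewrite liftK exprMn.
have -> : \sum_(f in A)
    ((t ^- B * ((multifact beta)%:R / d`!%:R * \prod_i w i (f i))) *:
     mpoly_of_dhomog (L f) ^+ d)@_m = t ^- B * t ^+ tdeg m * E m.
  rewrite /E bigA_distr_big_dep !mulr_sumr; apply: eq_bigr => f _.
  rewrite mcoeffZ coefL big_split /=; field.
  by rewrite mf_neq0 fact_neq0 expf_neq0.
have [lt_mB|le_Bm] := ltnP (tdeg m) B.
  by rewrite /E moments_eq0 // !mulr0.
by rewrite -[in RHS](subnK le_Bm) exprD [t ^- B * _]mulrC mulfK // expf_neq0.
Qed.

Lemma border_rank_monomial_le_weights :
  zariski_closure (rank_at_most (T_count tb)) (monomial C b).
Proof.
(* For d = 0 there are no d-th roots to take; the monomial is 1, the 0-th power of the zero form. *)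
have [d0|d_gt0] := posnP d.
  apply: zariski_closure_sub; apply: (@rank_at_most_sum _ _ _ _ _ 1).
    have b0 i : b i = 0%N.
      by move/eqP: d0; rewrite sum_nat_eq0 => /forallP/(_ i)/eqP.
    exists (fun=> 0); transitivity (1 : {mpoly C[n.+1]}).
      by rewrite /= big1 // => i _; rewrite b0 expr0.
    by rewrite big_ord1 [X in _ ^+ X]d0 expr0.
  by rewrite prodn_gt0.
rewrite -q0; apply: zariski_closure_curve => t t0.
exact: rank_at_most_sum (q_sum d_gt0 t0) (leqnn _).
Qed.

End UpperBound.

Lemma border_rank_monomial_le (C : numClosedFieldType) n (b : 'I_n.+1 -> nat) :
  zariski_closure (rank_at_most (T_count (fun i : 'I_n => b (lift ord0 i))))
    (monomial C b).
Proof.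
have [w wP] :=
  choice (fun i : 'I_n => interpolation_weights C (b (lift ord0 i))).
exact: border_rank_monomial_le_weights wP.
Qed.

Theorem theorem11p2 (R : realType) (n : nat) (b : 'I_n.+1 -> nat)
  (b_noninc : forall i j : 'I_n.+1, (i <= j)%N -> (b j <= b i)%N) :
  exists r : nat,
    [/\ is_border_rank (monomial R[i] b) r,
        (S_count b ((\sum_(i < n.+1) b i) %/ 2)%N%:Z <= r)%N
      & (r <= T_count (fun i : 'I_n => b (lift ord0 i)))%N].
Proof.
(* The upper bound also supplies the existence of the border rank: some admissible value is needed
   before a least one can be chosen. *)
have [r le_rT least_r] := @is_least_exists
  (fun s => zariski_closure (rank_at_most s) (monomial R[i] b)) _
  (border_rank_monomial_le (b := b)).
by exists r; split=> //; exact: border_rank_monomial_ge least_r.1.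
Qed.
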